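(* Let $p\in(0,1)$, $q=1-p$, and let $X_n$ be the number of correct guesses under the optimal strategy in the complete feedback game after one asymmetric single-shelf shuffle of $n$ cards with parameter $p$. For $x\in(1/2,1)$ set \[ y_p(x):=\frac{1-x+\sqrt{(1-x)^2+(1-4pq)(2x-1)}}{2x-1}, \] and define $I_p:\mathbb{R}\to[0,+\infty]$ by \[ I_p(x):=\begin{cases} (1-x)\log\dfrac{y_p(x)^2-(1-4pq)}{4pq}+\log\dfrac{2}{1+y_p(x)}, & 1/2<x<1,\\[2mm] \frac12\log\frac{1}{pq}, & x=1/2,\\[1mm] \log\frac{1}{\max\{p,1-p\}}, & x=1,\\[1mm] +\infty, & x\notin[1/2,1] \end{cases} \] (the values at $1/2$ and $1$ being the continuous extension of $I_p$ from $(1/2,1)$). Then $I_p$ is a good rate function and $X_n/n$ satisfies a large deviation principle with speed $n$ and good rate function $I_p$.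
   Context: Asymmetric single-shelf shuffle with parameter $p\in(0,1)$: start with an ordered deck of $n$ cards labelled $1,\dots,n$ (card $1$ on top). Cards are drawn one at a time from the bottom of the deck (card $n$ first, card $1$ last) and placed in a pile; independently, each drawn card is placed at the top of the pile with probability $p$ and at the bottom with probability $1-p$. Equivalently, let $\varepsilon_1,\dots,\varepsilon_{n-1}$ be independent Bernoulli$(p)$ ($\varepsilon_j=1$ iff card $j$ is placed at the top); the shuffled deck read from the top consists of the cards $j\le n-1$ with $\varepsilon_j=1$ in increasing order, then card $n$, then the cards with $\varepsilon_j=0$ in decreasing order. Complete feedback game: the player guesses the cards of the shuffled deck sequentially from the top; after each guess the card is shown and removed. Let $\nu=1$ if $p\ge\frac12$ and $\nu=\lfloor \log p/\log(1-p)\rfloor+1$ if $0<p<\frac12$. Optimal strategy used: let $j$ be the label of the last card shown ($j=0$ before the first guess). As long as neither card $n$ nor card $n-1$ has been shown: if $p\ge\frac12$, guess $j+1$; if $p<\frac12$, guess $n$ when $n-j\le\nu$ and guess $j+1$ when $n-j>\nu$. Once card $n$ or $n-1$ has been shown, guess the remaining cards in decreasing order. $X_n=X_n(p)$ denotes the number of correct guesses under this strategy. A good rate function is a lower semicontinuous $I:\mathbb{R}\to[0,+\infty]$ whose level sets $\{x\in\mathbb{R}: I(x)\le\alpha\}$ are compact for all $\alpha\in[0,\infty)$. A sequence of real random variables $(Y_n)_{n\ge1}$ satisfies a large deviation principle with speed $n$ and good rate function $I$ if for every Borel set $A\subseteq\mathbb{R}$, with interior $A^\circ$ and closure $\overline{A}$,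 \[ -\inf_{x\in A^\circ}I(x)\le\liminf_{n\to\infty}\frac1n\log\mathbb{P}(Y_n\in A)\le\limsup_{n\to\infty}\frac1n\log\mathbb{P}(Y_n\in A)\le-\inf_{x\in\overline{A}}I(x). \] *)

(* Defs.v *)
From HB Require Import structures.
From mathcomp Require Import all_boot all_order all_algebra.
From mathcomp Require Import all_classical all_reals all_analysis.

Set Implicit Arguments.
Unset Strict Implicit.
Unset Printing Implicit Defensive.

Import Order.TTheory GRing.Theory Num.Theory.
Import numFieldNormedType.Exports.

Local Open Scope classical_set_scope.
Local Open Scope ring_scope.

Definition good_rate_function {R : realType} (I : R -> \bar R) : Prop :=
  [/\ forall x, (0 <= I x)%E,
      lower_semicontinuous I
    & forall a : R, 0 <= a -> compact [set x | (I x <= a%:E)%E]].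

(* The variables may live on different probability spaces.  The term of index 0
   is irrelevant, since only the limits inferior and superior are used; the
   logarithm is extended by [lne 0 = -oo], and the infimum over the empty set
   is [+oo]. *)
Definition satisfies_LDP {R : realType} (d : nat -> measure_display)
    (T : forall n, measurableType (d n)) (P : forall n, probability (T n) R)
    (Y : forall n, {RV (P n) >-> R}) (I : R -> \bar R) : Prop :=
  let scaled_log_prob (A : set R) (n : nat) : \bar R :=
    ((n%:R^-1)%:E * lne (P n (Y n @^-1` A)))%E in
  good_rate_function I /\
  forall A : set R, measurable A ->
    [/\ (- ereal_inf (I @` interior A) <= limn_einf (scaled_log_prob A))%E,
        (limn_einf (scaled_log_prob A) <= limn_esup (scaled_log_prob A))%E
      & (limn_esup (scaled_log_prob A) <= - ereal_inf (I @` closure A))%E].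

Definition mutually_independent {R : realType} d (T : measurableType d)
    (P : probability T R) d' (T' : measurableType d') (J : finType)
    (X : J -> {RV P >-> T'}) : Prop :=
  forall (K : {set J}) (B : J -> set T'), (forall j, measurable (B j)) ->
    P (\bigcap_(j in [set` K]) (X j @^-1` B j)) =
    (\prod_(j in K) P (X j @^-1` B j))%E.

(* Card [k] (for 1 <= k <= n) is encoded by the index [k.-1 : 'I_n], and decks
   are listed from the top.  [foldr] treats the last index first, so that the
   cards are drawn in the order n, n-1, ..., 1; the coin of card n does not
   affect the result, as the pile is still empty. *)
Definition shuffled_deck (n : nat) (e : {ffun 'I_n -> bool}) : seq nat :=
  foldr (fun (i : 'I_n) (pile : seq nat) =>
           if e i then i.+1 :: pile else rcons pile i.+1)
        [::] (enum 'I_n).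

(* A strategy maps the list of cards already shown, in order of appearance, to
   the next guess. *)
Definition correct_guesses (strategy : seq nat -> nat) (deck : seq nat) : nat :=
  \sum_(0 <= k < size deck) (strategy (take k deck) == nth 0%N deck k).

Definition nu {R : realType} (p : R) : int :=
  if 2^-1 <= p then 1 else Num.floor (ln p / ln (1 - p)) + 1.

(* Guessing the remaining cards in decreasing order means always guessing the
   largest card not yet shown. *)
Definition optimal_strategy {R : realType} (p : R) (n : nat)
    (shown : seq nat) : nat :=
  let j := last 0%N shown in
  if (n \notin shown) && (n.-1 \notin shown) then
    if 2^-1 <= p then j.+1
    else if n%:Z - j%:Z <= nu p then n else j.+1
  else \max_(1 <= k < n.+1 | k \notin shown) k.

Definition num_correct {R : realType} (p : R) (n : nat)
    (e : {ffun 'I_n -> bool}) : nat :=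
  correct_guesses (optimal_strategy p n) (shuffled_deck e).

Definition scaled_correct {R : realType} (p : R) (n : nat) d
    (T : measurableType d) (P : probability T R)
    (eps : 'I_n -> {RV P >-> bool}) : T -> R :=
  fun w => (num_correct p [ffun i => eps i w])%:R / n%:R.

Section scaled_correct_RV.
Context {R : realType} (p : R) (n : nat) d (T : measurableType d).
Context (P : probability T R) (eps : 'I_n -> {RV P >-> bool}).

Lemma measurable_scaled_correct :
  measurable_fun [set: T] (scaled_correct p eps).
Proof.
move=> _ B _; rewrite setTI.
set g := fun e : {ffun 'I_n -> bool} => (num_correct p e)%:R / n%:R : R.
have -> : scaled_correct p eps @^-1` B =
    \bigcup_(e in [set e | B (g e)]) \bigcap_i (eps i @^-1` [set e i]).
  apply/seteqP; split => [w Bw | w [e /= Be ew]].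
    by exists [ffun i => eps i w] => // i _ /=; rewrite ffunE.
  rewrite /preimage /scaled_correct /=.
  suff -> : [ffun i => eps i w] = e by [].
  by apply/ffunP => i; rewrite ffunE; exact: ew.
apply: fin_bigcup_measurable => [|e _]; first exact: finite_finset.
apply: fin_bigcap_measurable => [|i _]; first exact: finite_finset.
by rewrite -[X in measurable X]setTI; exact: measurable_funP.
Qed.

HB.instance Definition _ := @isMeasurableFun.Build _ _ T R
  (scaled_correct p eps) measurable_scaled_correct.

Definition scaled_correct_RV : {RV P >-> R} := scaled_correct p eps.

End scaled_correct_RV.

Definition y_fun {R : realType} (p x : R) : R :=
  let q := 1 - p in
  (1 - x + Num.sqrt ((1 - x) ^+ 2 + (1 - 4 * p * q) * (2 * x - 1)))
    / (2 * x - 1).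

Definition rate {R : realType} (p x : R) : \bar R :=
  let q := 1 - p in
  if (2^-1 < x) && (x < 1) then
    ((1 - x) * ln ((y_fun p x ^+ 2 - (1 - 4 * p * q)) / (4 * p * q))
      + ln (2 / (1 + y_fun p x)))%:E
  else if x == 2^-1 then (2^-1 * ln (1 / (p * q)))%:E
  else if x == 1 then (ln (1 / Num.max p (1 - p)))%:E
  else +oo%E.

(* Main.v *)
Require Import Defs.
From HB Require Import structures.
From mathcomp Require Import all_boot all_order all_algebra.
From mathcomp Require Import zify ring lra.
From mathcomp Require Import all_classical all_reals all_analysis.

Set Implicit Arguments.
Unset Strict Implicit.
Unset Printing Implicit Defensive.

Import Order.TTheory GRing.Theory Num.Theory.
Import numFieldNormedType.Exports.

Local Open Scope classical_set_scope.
Local Open Scope ring_scope.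

(** Write a deck as the coin sequence e_1, ..., e_n of the shuffle.  Before card
    n appears the deck runs increasingly through the heads, and after it
    decreasingly through the tails.  Guessing the successor of the last card is
    right exactly when two consecutive cards both have heads, so the guess of a
    head h is lost exactly when card h - 1 has tails; the decreasing part is
    guessed perfectly.  Hence, up to an error bounded by a constant depending
    only on p (card n itself, and the few guesses affected by [nu]), the number
    of correct guesses is n - W, where W counts the rises of the coin sequence,
    i.e. the positions where tails is followed by heads
    ([num_correct_add_rises]).

    The moment generating function of W obeys a two-term linear recursion,
    whose dominant root is
      lambda(theta) = (1 + y) / 2,
      y = sqrt (1 - 4 p q + 4 p q exp theta).
    It lies between c lambda^n and (n + 1) lambda^n ([rise_mgf_ge],
    [rise_mgf_le]), and the upper bound is uniform in theta.  The logarithmic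
    derivative of lambda at theta is (y^2 - (1 - 4 p q)) / (2 y (1 + y)), and
    solving for y the equation that this be 1 - x gives the formula for y_p(x).
    So I_p(x) = (1 - x) theta - ln lambda(theta) is the Legendre transform of
    ln lambda ([rate_legendre]).

    The upper bound is Chernoff's inequality applied to each of the n + 1
    values of W ([prob_upper]).  Compactness of the sublevel sets of I_p
    absorbs the bounded error ([prob_upper_closure]).  The lower bound comes
    from exponential tilting: weighting by exp (theta W) moves the mean of W
    to about n (1 - x), and differentiability of ln lambda at theta, again through
    Chernoff, makes both tails of the tilted law exponentially small
    ([prob_lower]).  The boundary points 1/2 and 1 are reached through the
    continuity of I_p, and I_p >= 0 because the probabilities that it bounds
    from below are at most 1 ([rate_ge0]). *)

(** * Correct guesses and rises of the coin sequence *)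

(** The boolean argument is the coin preceding the sequence. *)
Fixpoint rises (b : bool) (s : seq bool) : nat :=
  if s is x :: s' then ((~~ b && x) + rises x s')%N else 0%N.

(** The score on [s] of always naming the successor of the last card, when [j]
    is shown first. *)
Definition successions (j : nat) (s : seq nat) : nat :=
  sumn (pairmap (fun j h => (j.+1 == h : nat)%N) j s).

Lemma rises_le_half b s : ((rises b s).*2 <= size s + ~~ b)%N.
Proof.
elim: s b => [|x s IHs] b //=.
by have := IHs x; case: b; case: x => /=;
  rewrite ?add0n ?addn0 ?add1n ?addn1 ?doubleS //= => h;
  rewrite ?ltnS //; apply: leq_trans h _.
Qed.

Lemma rises_rcons b s x :
  (rises b s <= rises b (rcons s x) <= (rises b s).+1)%N.
Proof.
elim: s b => [|y s IHs] b /=; first by case: b; case: x.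
by have /andP[h1 h2] := IHs y; rewrite leq_add2l h1 -addnS leq_add2l h2.
Qed.

(** Each head either follows a head, and is then a succession of the list of
    heads, or follows a tail, and is then a rise.  The last head before the
    window, [j], determines the coin just before it only through [j.+1 == m]. *)
Lemma successions_add_rises (E : nat -> bool) (j m k : nat) : (j < m)%N ->
  (successions j [seq i <- iota m k | E i] +
     rises (j.+1 == m) [seq E i | i <- iota m k] = count E (iota m k))%N.
Proof.
rewrite /successions.
elim: k j m => [|k IHk] j m ltjm //=.
case Em: (E m) => /=.
  have := IHk m m.+1 (ltnSn m); rewrite eqxx => <-.
  by rewrite andbT; case: eqP => _ /=; rewrite ?add0n // addnCA addnA.
rewrite andbF !add0n -(IHk j m.+1) ?ltnS ?(ltnW ltjm) //.
by rewrite eqSS (ltn_eqF ltjm).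
Qed.

Lemma correct_guesses_cons st x s : correct_guesses st (x :: s) =
  ((st [::] == x) + correct_guesses (fun t => st (x :: t)) s)%N.
Proof. by rewrite /correct_guesses /= big_nat_recl. Qed.

Lemma correct_guesses_cat st s1 s2 : correct_guesses st (s1 ++ s2) =
  (correct_guesses st s1 + correct_guesses (fun t => st (s1 ++ t)) s2)%N.
Proof.
elim: s1 st => [|x s IHs] st /=; first by rewrite {2}/correct_guesses big_geq.
by rewrite !correct_guesses_cons IHs addnA.
Qed.

Lemma correct_guesses_all st s :
  (forall k, (k < size s)%N -> st (take k s) = nth 0%N s k) ->
  correct_guesses st s = size s.
Proof.
elim: s st => [|x s IHs] st st_s; first by rewrite /correct_guesses big_geq.
rewrite correct_guesses_cons IHs => [|k ltks]; last exact: (st_s k.+1).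
by rewrite (st_s 0%N) //= eqxx.
Qed.

(** A strategy that guesses the successor while the last card is below [b]
    can differ from the pure successor strategy only at the steps that start
    from a card which is at least [b]. *)
Lemma correct_guesses_successor st (b j : nat) s :
  (forall k, (k < size s)%N -> (last j (take k s) < b)%N ->
     st (take k s) = (last j (take k s)).+1) ->
  let c := count (leq b) (belast j s) in
  (correct_guesses st s <= successions j s + c)%N /\
  (successions j s <= correct_guesses st s + c)%N.
Proof.
rewrite /successions.
elim: s j st => [|x s IHs] j st st_s /=.
  by rewrite /correct_guesses big_geq.
have [k ks h|] := IHs x (fun t => st (x :: t)); first exact: (st_s k.+1).
rewrite correct_guesses_cons.
set c := count _ _; set C := correct_guesses _ _; set S := sumn _ => h1 h2.
have [lebj|ltjb] := leqP b j.
  by case: (st [::] == x); case: (j.+1 == x); lia.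
by rewrite (st_s 0%N) //=; lia.
Qed.

Lemma count_geq_sub_iota (b n : nat) (s : seq nat) :
  uniq s -> {in s, forall j, (j < n)%N} -> (count (leq b) s <= n - b)%N.
Proof.
move=> us ltsn; rewrite -size_filter -(size_iota b (n - b)).
apply: uniq_leq_size; first exact: filter_uniq.
by move=> j; rewrite mem_filter mem_iota => /andP[lebj /ltsn ltjn]; lia.
Qed.

(** Once the remaining cards are in decreasing order, the largest card not
    yet shown is the next one. *)
Lemma bigmax_unshown (n : nat) (shown : seq nat) x rest :
  perm_eq (shown ++ x :: rest) (iota 1 n) -> all (geq x) rest ->
  (\max_(1 <= k < n.+1 | k \notin shown) k)%N = x.
Proof.
move=> deckE /allP restP.
have u : uniq (shown ++ x :: rest) by rewrite (perm_uniq deckE) iota_uniq.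
apply/eqP; rewrite eqn_leq; apply/andP; split.
  apply/bigmax_leqP_seq => k; rewrite mem_index_iota => kn kNs.
  have := mem_iota 1 n k; rewrite add1n kn -(perm_mem deckE) mem_cat.
  by rewrite (negbTE kNs) inE /= => /orP[/eqP->//|/restP].
have xNs : x \notin shown.
  by move: u; rewrite uniq_catC /= mem_cat => /andP[/norP[]].
apply: (@leq_bigmax_seq _ _ _ (fun k => k)) => //.
by rewrite mem_index_iota -add1n -mem_iota -(perm_mem deckE) mem_cat inE eqxx orbT.
Qed.

Lemma foldr_pile (E : nat -> bool) (s pile : seq nat) :
  foldr (fun i pile => if E i then i :: pile else rcons pile i) pile s =
  [seq i <- s | E i] ++ pile ++ rev [seq i <- s | ~~ E i].
Proof.
elim: s => [|i s IHs] /=; first by rewrite cats0.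
by rewrite IHs; case: (E i) => //=; rewrite rev_cons -!rcons_cat.
Qed.

Lemma shuffled_deckE (m : nat) (e : {ffun 'I_m.+1 -> bool}) :
  let E i := nth false [seq e i | i <- enum 'I_m.+1] i.-1 in
  shuffled_deck e = [seq i <- iota 1 m | E i] ++
    m.+1 :: rev [seq i <- iota 1 m | ~~ E i].
Proof.
move=> E.
have -> : shuffled_deck e =
  foldr (fun i pile => if E i then i :: pile else rcons pile i) [::] (iota 1 m.+1).
  rewrite (iotaDl 1 0) -val_enum_ord -map_comp foldr_map /shuffled_deck.
  apply: (congr1 (fun f => foldr f [::] (enum 'I_m.+1))).
  apply/funext => i; apply/funext => s.
  have -> : (addn 1 \o \val) i = i.+1 by rewrite /= add1n.
  by rewrite /E /= (nth_map i) ?nth_ord_enum ?size_enum_ord.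
rewrite -[X in iota _ X]addn1 iotaD foldr_cat /=.
have -> : (if E (1 + m)%N then [:: (1 + m)%N] else [:: (1 + m)%N]) = [:: m.+1].
  by case: ifP.
by rewrite foldr_pile.
Qed.

(** The heads contribute their successions, up to the at most [n - b] steps
    that start from a card which is at least [b]; all the tails are guessed;
    card [n] contributes at most one.  Successions are complementary to rises,
    and the coin of card [n], which does not move the deck, creates at most one
    more rise. *)
Lemma correct_guesses_shuffled (st : seq nat -> nat) (b n : nat)
    (e : {ffun 'I_n -> bool}) :
  (forall shown, n \notin shown -> n.-1 \notin shown ->
     (last 0%N shown < b)%N -> st shown = (last 0%N shown).+1) ->
  (forall shown, n \in shown ->
     st shown = (\max_(1 <= k < n.+1 | k \notin shown) k)%N) ->
  let X := correct_guesses st (shuffled_deck e) in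
  let W := rises true [seq e i | i <- enum 'I_n] in
  (n <= X + W + (n - b + 1) /\ X + W <= n + (n - b + 1))%N.
Proof.
case: n e => [|m] e st_before st_after X W.
  by rewrite /X /W /shuffled_deck; case: (enum _) (size_enum_ord 0) => //= _;
     rewrite /correct_guesses big_geq.
(* Card [i] has the coin of index [i.-1]. *)
pose E i := nth false [seq e i | i <- enum 'I_m.+1] i.-1.
set H := [seq i <- iota 1 m | E i].
set T := rev [seq i <- iota 1 m | ~~ E i].
have deckE : shuffled_deck e = H ++ m.+1 :: T by exact: shuffled_deckE.
have TE : correct_guesses (fun s => st (H ++ m.+1 :: s)) T = size T.
  apply: correct_guesses_all => k ltk.
  rewrite st_after; last by rewrite mem_cat inE eqxx orbT.
  apply: (@bigmax_unshown m.+1 _ _ (drop k.+1 T)).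
    rewrite -catA cat_cons -drop_nth // cat_take_drop.
    rewrite -[X in iota _ X]addn1 iotaD add1n -cat1s perm_catCA perm_catC perm_cat2r.
    rewrite (perm_catl _ (permEl (perm_rev _))); exact: (permEl (perm_filterC E _)).
  have : sorted geq T.
    rewrite rev_sorted; apply: sorted_filter; first exact: leq_trans.
    exact: iota_sorted.
  rewrite -{1}(cat_take_drop k T) (drop_nth 0%N) // => /cat_sorted2[_] /=.
  apply: order_path_min => x y z h1 h2; exact: leq_trans h2 h1.
have HleM : {in H, forall i, (i <= m)%N}.
  by move=> i; rewrite mem_filter mem_iota add1n ltnS => /and3P[].
have uH0 : uniq (belast 0 H).
  have : subseq (belast 0 H) (0 :: H) by rewrite lastI subseq_rcons.
  move=> /subseq_uniq; apply; rewrite /= filter_uniq ?iota_uniq // andbT.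
  by rewrite mem_filter mem_iota andbF.
have cH : (count (leq b) (belast 0 H) <= m.+1 - b)%N.
  apply: count_geq_sub_iota => // i /mem_belast; rewrite inE => /orP[/eqP->//|].
  by move=> /HleM.
have lastH k : (k < size H)%N -> (m.+1 \notin take k H) && (m \notin take k H).
  move=> ltk; have sH : sorted ltn H.
    by apply: sorted_filter; [exact: ltn_trans | exact: iota_ltn_sorted].
  apply/andP; split; apply/negP.
    by move=> /mem_take /HleM; rewrite ltnn.
  move=> mk; have ltik : (index m (take k H) < k)%N.
    by move: mk; rewrite -index_mem size_take ltk.
  have := sorted_ltn_nth ltn_trans 0%N sH _ _ (ltn_trans ltik ltk) ltk ltik.
  rewrite -(nth_take _ ltik) nth_index // ltnNge => /negP; apply.
  by apply: HleM; rewrite mem_nth.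
have [|h1 h2] := @correct_guesses_successor st b 0 H.
  by move=> k /lastH/andP[]; exact: st_before.
have h3 := @successions_add_rises E 0 1 m isT.
have WE : [seq e i | i <- enum 'I_m.+1] = rcons [seq E i | i <- iota 1 m] (E m.+1).
  have sE : size [seq e i | i <- enum 'I_m.+1] = m.+1.
    by rewrite size_map size_enum_ord.
  rewrite -[LHS](mkseq_nth false) sE.
  rewrite -map_rcons -cats1 -[X in _ ++ [:: X]]add1n -(iotaD 1 m 1) addn1.
  rewrite (iotaDl 1 0) -map_comp.
  by apply: eq_map => i /=; rewrite /E add1n.
have := rises_rcons true [seq E i | i <- iota 1 m] (E m.+1).
rewrite -WE -/W => /andP[h4 h5].
have sizeE : (count E (iota 1 m) + size T = m)%N.
  by rewrite size_rev size_filter count_predC size_iota.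
have XE : X = (correct_guesses st H + ((st (H ++ [::]) == m.+1) + size T))%N.
  by rewrite /X deckE correct_guesses_cat correct_guesses_cons TE.
move: h1 h2 XE h3; rewrite -/H eqxx.
by case: (_ == m.+1); lia.
Qed.

Lemma num_correct_add_rises (R : realType) (p : R) (n : nat)
    (e : {ffun 'I_n -> bool}) :
  let X := num_correct p e in
  let W := rises true [seq e i | i <- enum 'I_n] in
  (n <= X + W + `|nu p|.+1 /\ X + W <= n + `|nu p|.+1)%N.
Proof.
have [shown nNs n1Ns ltb|shown ns|h1 h2] :=
  @correct_guesses_shuffled (optimal_strategy p n) (n - `|nu p|) n e.
- rewrite /optimal_strategy nNs n1Ns /=; case: ifP => // _.
  by rewrite ifF //; apply/negbTE; lia.
- by rewrite /optimal_strategy ns.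
- by split; [apply: leq_trans h1 _|apply: leq_trans h2 _]; rewrite /num_correct; lia.
Qed.

(** * The moment generating function of the number of rises *)

Section generating_function.
Context {R : realType}.
Variable p : R.
Hypotheses (p_gt0 : 0 < p) (p_lt1 : p < 1).

Definition weight (t : seq bool) : R := \prod_(x <- t) (if x then p else 1 - p).

(** As in [rises], [b] is the coin preceding the sequence: conditioning on the
    first coin gives a recursion between the two values of [b]. *)
Definition rise_mgf (b : bool) (n : nat) (theta : R) : R :=
  \sum_(t : n.-tuple bool) weight t * expR (theta * (rises b t)%:R).

Lemma weight_gt0 t : 0 < weight t.
Proof. by apply: prodr_gt0 => -[] _ /=; rewrite ?subr_gt0. Qed.

Lemma sum_tupleS (n : nat) (F : seq bool -> R) :
  \sum_(t : n.+1.-tuple bool) F t =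
  \sum_(t : n.-tuple bool) F (true :: t) + \sum_(t : n.-tuple bool) F (false :: t).
Proof.
rewrite (reindex (fun xt : bool * n.-tuple bool => [tuple of xt.1 :: xt.2])) /=.
  by rewrite -(pair_bigA _ (fun x (t : n.-tuple bool) => F (x :: t))) /= big_bool.
exists (fun t : n.+1.-tuple bool => (thead t, [tuple of behead t])) => [[x t]|t] _ /=.
  by rewrite theadE; congr pair; apply/val_inj.
by rewrite [RHS]tuple_eta; apply/val_inj.
Qed.

Lemma rise_mgf0 b theta : rise_mgf b 0 theta = 1.
Proof.
rewrite /rise_mgf (big_pred1 [tuple of [::]]) => [|t]; last by apply/esym/eqP; exact: tuple0.
by rewrite /weight big_nil /= mulr0 expR0 mulr1.
Qed.

Lemma rise_mgfS b n theta : rise_mgf b n.+1 theta =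
  p * expR (theta * (~~ b)%:R) * rise_mgf true n theta + (1 - p) * rise_mgf false n theta.
Proof.
rewrite /rise_mgf (sum_tupleS n (fun t => weight t * expR (theta * (rises b t)%:R))).
rewrite !mulr_sumr; congr (_ + _); apply: eq_bigr => t _ /=.
  by rewrite /weight big_cons andbT natrD mulrDr expRD; ring.
by rewrite /weight big_cons andbF add0n; ring.
Qed.

Lemma rise_mgf_true1 theta : rise_mgf true 1 theta = 1.
Proof. by rewrite rise_mgfS !rise_mgf0 mulr0 expR0; ring. Qed.

(** Eliminating [rise_mgf false] from the recursion [rise_mgfS] leaves a
    recursion whose characteristic polynomial is that of the tilted transfer
    matrix between consecutive coins. *)
Lemma rise_mgf_rec n theta : rise_mgf true n.+2 theta =
  rise_mgf true n.+1 theta + p * (1 - p) * (expR theta - 1) * rise_mgf true n theta.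
Proof.
rewrite 2!rise_mgfS (rise_mgfS false) /= mulr0 mulr1 expR0; ring.
Qed.

Definition root_disc (theta : R) : R :=
  Num.sqrt (1 - 4 * p * (1 - p) + 4 * p * (1 - p) * expR theta).

(** The Perron-Frobenius eigenvalue of the tilted transfer matrix, i.e. the
    larger root of X^2 - X = p q (exp theta - 1).  The other root is
    [1 - pf_eigenvalue theta]. *)
Definition pf_eigenvalue (theta : R) : R := (1 + root_disc theta) / 2.
Local Notation y := root_disc.
Local Notation lam := pf_eigenvalue.

Lemma disc_ge0 : 0 <= 1 - 4 * p * (1 - p).
Proof. by rewrite (_ : _ - _ = (1 - 2 * p) ^+ 2) ?sqr_ge0//; ring. Qed.

Lemma root_disc_arg_gt0 theta :
  0 < 1 - 4 * p * (1 - p) + 4 * p * (1 - p) * expR theta.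
Proof.
apply: ltr_wpDl; first exact: disc_ge0.
by rewrite !mulr_gt0 ?expR_gt0 ?subr_gt0.
Qed.

Lemma sqr_root_disc theta :
  root_disc theta ^+ 2 = 1 - 4 * p * (1 - p) + 4 * p * (1 - p) * expR theta.
Proof. by rewrite sqr_sqrtr// ltW// root_disc_arg_gt0. Qed.

Lemma root_disc_gt0 theta : 0 < root_disc theta.
Proof. by rewrite sqrtr_gt0 root_disc_arg_gt0. Qed.

Lemma pf_eigenvalue_gt0 theta : 0 < lam theta.
Proof. by have := root_disc_gt0 theta; rewrite /lam; lra. Qed.

Lemma pf_charpoly theta :
  (1 - lam theta) * lam theta = - (p * (1 - p) * (expR theta - 1)).
Proof. have := sqr_root_disc theta; rewrite /lam => h. by nra. Qed.

(** Removing the dominant root from the recursion leaves a geometric sequence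
    in the other root. *)
Lemma rise_mgfS_sub n theta :
  rise_mgf true n.+1 theta = lam theta * rise_mgf true n theta + (1 - lam theta) ^+ n.+1.
Proof.
elim: n => [|n IHn]; first by rewrite rise_mgf_true1 rise_mgf0; ring.
rewrite rise_mgf_rec exprS.
have -> : (1 - lam theta) ^+ n.+1 =
    rise_mgf true n.+1 theta - lam theta * rise_mgf true n theta.
  by rewrite IHn; ring.
rewrite [p * _ * _](_ : _ = - ((1 - lam theta) * lam theta)); first by ring.
by rewrite pf_charpoly opprK.
Qed.

(** The other root is at most the dominant one in absolute value, so
    [rise_mgfS_sub] adds at most one copy of the dominant power at each step.
    The prefactor is uniform in [theta], which lets Chernoff bounds be applied
    with a [theta] depending on the value of [rises]. *)
Lemma rise_mgf_le n theta : rise_mgf true n theta <= n.+1%:R * lam theta ^+ n.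
Proof.
have y0 := root_disc_gt0 theta; have l0 := pf_eigenvalue_gt0 theta.
elim: n => [|n IHn]; first by rewrite rise_mgf0 expr0 mulr1.
rewrite rise_mgfS_sub -natr1 mulrDl mul1r; apply: lerD.
  by rewrite exprS mulrCA ler_pM2l.
apply: le_trans (ler_norm _) _; rewrite normrX lerXn2r ?nnegrE ?(ltW l0)//.
by rewrite ler_norml /lam; apply/andP; split; lra.
Qed.

(** For [theta <= 0] both roots are nonnegative and [rise_mgfS_sub] only adds.
    For [theta >= 0] all the coefficients of [rise_mgf_rec] are nonnegative,
    and the powers of the root satisfy the same recursion. *)
Lemma rise_mgf_ge theta :
  exists2 c : R, 0 < c & forall n, c * lam theta ^+ n <= rise_mgf true n theta.
Proof.
have y0 := root_disc_gt0 theta; have l0 := pf_eigenvalue_gt0 theta.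
have [t0|t0] := leP 0 theta.
  exists (lam theta)^-1 => [|n]; first by rewrite invr_gt0.
  rewrite mulrC ler_pdivrMr//.
  suff [] : lam theta ^+ n <= rise_mgf true n theta * lam theta /\
    lam theta ^+ n.+1 <= rise_mgf true n.+1 theta * lam theta by [].
  have l1 : 1 <= lam theta.
    have : 1 <= y theta.
      rewrite -[1]sqrtr1 ler_wsqrtr//.
      have : 1 <= expR theta by rewrite -expR0 ler_expR.
      have : 0 < 4 * p * (1 - p) by rewrite !mulr_gt0 ?subr_gt0.
      by nra.
    by rewrite /lam; lra.
  elim: n => [|n [IH1 IH2]]; first by rewrite rise_mgf0 rise_mgf_true1 !mul1r expr0 expr1.
  split=> //; rewrite rise_mgf_rec mulrDl.
  rewrite (_ : lam theta ^+ n.+2 = lam theta ^+ n.+1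
    - (1 - lam theta) * lam theta * lam theta ^+ n); last by rewrite !exprS; ring.
  apply: lerD => //; rewrite pf_charpoly mulNr opprK -[leRHS]mulrA ler_wpM2l//.
  by rewrite mulr_ge0 ?mulr_ge0 ?subr_ge0 ?(ltW p_gt0) ?(ltW p_lt1)// -expR0 ler_expR.
exists 1 => // n; rewrite mul1r.
have l1 : lam theta <= 1.
  have : y theta <= 1.
    rewrite -[leRHS]sqrtr1 ler_wsqrtr//.
    have : expR theta < 1 by rewrite -expR0 ltr_expR.
    have : 0 < 4 * p * (1 - p) by rewrite !mulr_gt0 ?subr_gt0.
    by nra.
  by rewrite /lam; lra.
elim: n => [|n IHn]; first by rewrite rise_mgf0 expr0.
rewrite rise_mgfS_sub exprS; apply: ler_wpDr; first by rewrite exprn_ge0// subr_ge0.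
by rewrite ler_pM2l.
Qed.

Lemma is_derive_ln_pf (theta : R) :
  is_derive theta 1 (@ln R \o lam)
    ((y theta ^+ 2 - (1 - 4 * p * (1 - p))) / (2 * y theta * (1 + y theta))).
Proof.
have y0 := root_disc_gt0 theta; have l0 := pf_eigenvalue_gt0 theta.
have a0 := root_disc_arg_gt0 theta.
have d1 : is_derive theta 1
    (fun t => 1 - 4 * p * (1 - p) + 4 * p * (1 - p) * expR t)
    (4 * p * (1 - p) * expR theta).
  by apply: is_derive_eq; rewrite add0r mul1r.
have d2 : is_derive theta 1 y ((2 * y theta)^-1 * (4 * p * (1 - p) * expR theta)).
  exact: (@is_derive1_comp R (@Num.sqrt R)
    (fun t => 1 - 4 * p * (1 - p) + 4 * p * (1 - p) * expR t) theta _ _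
    (is_derive1_sqrt a0) d1).
have d3 : is_derive theta 1 lam
    ((2 * y theta)^-1 * (4 * p * (1 - p) * expR theta) * 2^-1).
  rewrite (_ : lam = fun t => 2^-1 * (1 + y t)).
    by apply: is_derive_eq; rewrite add0r mul1r [RHS]mulrC.
  by apply/funext => t; rewrite /lam mulrC.
apply: is_derive_eq (is_derive1_comp (is_derive1_ln l0) d3) _.
rewrite sqr_root_disc /lam; field.
by rewrite !gt_eqF//; lra.
Qed.
End generating_function.

(** * Continuity of the rate function *)

Section rate_function.
Context {R : realType}.
Variable p : R.

(** The inequality [ln u <= u - 1] at u = 1 / sqrt t. *)
Lemma xlnx_le (t : R) : 0 < t -> t <= 1 -> `|t * ln t| <= 2 * Num.sqrt t.
Proof.
move=> t0 t1; have s0 : 0 < Num.sqrt t by rewrite sqrtr_gt0.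
have tE : t = Num.sqrt t ^+ 2 by rewrite sqr_sqrtr// ltW.
set s := Num.sqrt t in s0 tE *; rewrite {}tE.
have s1 : s <= 1 by rewrite /s -sqrtr1 ler_wsqrtr.
rewrite lnXn// ler0_norm.
  have : ln s^-1 <= s^-1 - 1.
    have -> : s^-1 = 1 + (s^-1 - 1) by ring.
    rewrite [leRHS](_ : _ = s^-1 - 1); last by ring.
    by apply: le_ln1Dx; rewrite ltrBrDr addrC subrr invr_gt0.
  rewrite lnV ?posrE// => h.
  have : s * - ln s <= 1 - s.
    by rewrite -(ler_pM2l s0) in h; rewrite (le_trans h)// mulrBr divff ?gt_eqF//; lra.
  by rewrite mulr2n => h2; nra.
have : ln s <= 0 by rewrite ln_le0.
by rewrite mulr2n; nra.
Qed.

(** The logarithm is 0 on nonpositive numbers, so this holds on the whole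
    line; it accounts for the boundary terms of the rate function. *)
Lemma continuous_xlnx : continuous (fun t : R => t * ln t).
Proof.
move=> t; have [t0|t0|t0] := ltrgtP 0 t.
- by apply: cvgM => //; exact: continuous_ln.
- apply: cvg_near_cst; rewrite (ln0 (ltW t0)) mulr0.
  near=> s; rewrite ln0 ?mulr0//.
  by apply: ltW; near: s; exact: lt_nbhsl.
- rewrite -t0 /continuous_at mul0r.
  apply/cvgrPdist_le => e e0.
  have e2 : 0 < e / 2 by rewrite divr_gt0.
  near=> s; rewrite sub0r normrN.
  have [s0|s0] := leP s 0; first by rewrite ln0// mulr0 normr0 ltW.
  apply: le_trans (xlnx_le s0 _) _.
    by near: s; apply: lt_le_nbhsl; exact: ltr01.
  rewrite mulrC -ler_pdivlMr// -(ger0_norm (ltW e2)) -sqrtr_sqr ler_wsqrtr//.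
  by near: s; apply: lt_le_nbhsl; rewrite exprn_gt0.
Unshelve. all: by end_near.
Qed.

Let c : R := 1 - 4 * p * (1 - p).

(** The numerator of [y_fun]. *)
Definition rate_root (x : R) : R :=
  1 - x + Num.sqrt ((1 - x) ^+ 2 + c * (2 * x - 1)).
Local Notation N := rate_root.

(** The rate function with the singular quotients cleared:
    y^2 - (1 - 4 p q) = 2 (1 - x) y (1 + y) turns the logarithms of [rate] into
    those of 1 - x, 2 x - 1, [rate_root] and 2 x - 1 + [rate_root].  This form
    is continuous up to both endpoints. *)
Definition rate_real (x : R) : R :=
  (2 * (1 - x)) * ln (2 * (1 - x)) / 2 + (1 - x) * ln (N x)
  - x * ln (2 * x - 1 + N x) + (2 * x - 1) * ln (2 * x - 1)
  - (1 - x) * ln (4 * p * (1 - p)) + ln 2.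

Lemma c_ge0 : 0 <= c. Proof. exact: disc_ge0. Qed.
Lemma rate_rootD_gt0 x : 2^-1 <= x <= 1 -> 0 < 2 * x - 1 + N x.
Proof.
move=> /andP[x1 x2]; rewrite /rate_root.
have := sqrtr_ge0 ((1 - x) ^+ 2 + c * (2 * x - 1)).
by move: (Num.sqrt _) => s; lra.
Qed.

Lemma continuous_rate_root : continuous N.
Proof.
move=> x; apply: cvgD; first by apply: cvgB => //; exact: cvg_cst.
apply: continuous_cvg; first exact: sqrt_continuous.
have cB : (1 - t) @[t --> x] --> 1 - x by apply: cvgB => //; exact: cvg_cst.
apply: cvgD; first exact: (cvgM cB cB).
by apply: cvgMr; apply: cvgB; [apply: cvgMr|exact: cvg_cst].
Qed.

(** Every logarithm is multiplied by a factor that vanishes with its argument,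
    or has a positive argument.  The delicate term is the logarithm of
    [rate_root], which vanishes at x = 1 when p = 1/2; there [rate_root] is just
    twice the positive part of 1 - x. *)
Lemma continuous_rate_real x : 2^-1 <= x <= 1 -> {for x, continuous rate_real}.
Proof.
move=> hx; have /andP[x1 x2] := hx.
have cB : {for x, continuous (fun x : R => 1 - x)} by apply: cvgB => //; exact: cvg_cst.
have cZ : {for x, continuous (fun x : R => 2 * x - 1)}.
  by apply: cvgB; [apply: cvgMr|exact: cvg_cst].
have cW : {for x, continuous (fun x : R => 2 * (1 - x))} by apply: cvgMr.
have cX : {for x, continuous (fun x : R => 2 * (1 - x) * ln (2 * (1 - x)))}.
  exact: (@cvg_comp _ _ _ _ (fun t => t * ln t) _ _ _ cW (@continuous_xlnx _)).
have cXZ : {for x, continuous (fun x : R => (2 * x - 1) * ln (2 * x - 1))}.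
  exact: (@cvg_comp _ _ _ _ (fun t => t * ln t) _ _ _ cZ (@continuous_xlnx _)).
have cN : {for x, continuous (fun x : R => (1 - x) * ln (N x))}.
  have [c0|c0] := eqVneq c 0.
    rewrite (_ : (fun x => _) = fun x => 2 * (1 - x) * ln (2 * (1 - x)) / 2).
      by apply: cvgMl.
    apply/funext => t; rewrite /rate_root c0 mul0r addr0 sqrtr_sqr.
    have [t1|t1] := leP t 1.
      rewrite ger0_norm ?subr_ge0// (_ : 1 - t + (1 - t) = 2 * (1 - t)); [by field|ring].
    rewrite ltr0_norm ?subr_lt0// subrr ln0// [in RHS]ln0; last by lra.
    by rewrite !mulr0 mul0r.
  apply: cvgM => //.
  apply: continuous_cvg; last exact: continuous_rate_root.
  apply: continuous_ln; rewrite /rate_root.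
  have c1 : 0 < c by rewrite lt_neqAle eq_sym c0 c_ge0.
  have [xlt1|] := ltP x 1; first by rewrite ltr_wpDr ?sqrtr_ge0 ?subr_gt0.
  move=> x1'; rewrite ltr_wpDl ?subr_ge0// sqrtr_gt0 ltr_wpDl ?sqr_ge0//.
  by rewrite mulr_gt0//; lra.
have cD : {for x, continuous (fun x : R => x * ln (2 * x - 1 + N x))}.
  apply: cvgM => //.
  apply: continuous_cvg; last by apply: cvgD; [exact: cZ|exact: continuous_rate_root].
  by apply: continuous_ln; exact: rate_rootD_gt0.
apply: cvgD; last exact: cvg_cst.
apply: cvgB; last by apply: cvgMl.
apply: cvgD => //; apply: cvgB => //; apply: cvgD => //.
by apply: cvgMl.
Qed.
End rate_function.

(** * The rate function as a Legendre transform *)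

Section rate_properties.
Context {R : realType}.
Variable p : R.
Hypotheses (p_gt0 : 0 < p) (p_lt1 : p < 1).
Local Notation N := (rate_root p).
Let c : R := 1 - 4 * p * (1 - p).

Lemma pq4_gt0 : 0 < 4 * p * (1 - p).
Proof. by rewrite !mulr_gt0 ?subr_gt0. Qed.

Lemma rate_root_quad x : 2^-1 <= x -> N x ^+ 2 = 2 * (1 - x) * N x + c * (2 * x - 1).
Proof.
move=> x1; have c0 : 0 <= c := disc_ge0 p.
have : Num.sqrt ((1 - x) ^+ 2 + c * (2 * x - 1)) ^+ 2 = (1 - x) ^+ 2 + c * (2 * x - 1).
  by rewrite sqr_sqrtr// addr_ge0 ?sqr_ge0// mulr_ge0//; lra.
by rewrite /rate_root -/c; move: (Num.sqrt _) => s h; nra.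
Qed.

Lemma rate_root_gt0 x : x < 1 -> 0 < N x.
Proof. by move=> x1; rewrite ltr_wpDr ?sqrtr_ge0 ?subr_gt0. Qed.

Lemma y_fun_gt0 x : 2^-1 < x < 1 -> 0 < y_fun p x.
Proof.
by case/andP=> x1 x2; rewrite divr_gt0//; [exact: rate_root_gt0|lra].
Qed.

(** This quadratic equation for y says that the logarithmic derivative of
    [pf_eigenvalue] is 1 - x. *)
Lemma y_fun_quad x : 2^-1 < x < 1 ->
  (2 * x - 1) * y_fun p x ^+ 2 = 2 * (1 - x) * y_fun p x + c.
Proof.
case/andP=> x1 x2; have := rate_root_quad (ltW x1).
have z0 : 2 * x - 1 != 0 by lra.
rewrite /y_fun -/(N x) => h.
have -> : (2 * x - 1) * (N x / (2 * x - 1)) ^+ 2 = N x ^+ 2 / (2 * x - 1) by field.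
by rewrite h; field.
Qed.

Lemma y_fun_sqrB x : 2^-1 < x < 1 ->
  y_fun p x ^+ 2 - c = 2 * (1 - x) * (y_fun p x * (1 + y_fun p x)).
Proof. by move=> /y_fun_quad h; nra. Qed.

Lemma y_fun_sqrB_gt0 x : 2^-1 < x < 1 -> 0 < y_fun p x ^+ 2 - c.
Proof.
move=> hx; have y0 := y_fun_gt0 hx; rewrite y_fun_sqrB//.
case/andP: hx => x1 x2; move: (y_fun p x) y0 => y y0.
by rewrite !mulr_gt0 ?subr_gt0 ?addr_gt0.
Qed.

Lemma rate_itvE x : 2^-1 <= x <= 1 -> rate p x = (rate_real p x)%:E.
Proof.
move=> hx; have /andP[x1 x2] := hx.
have N0 := rate_rootD_gt0 p hx; have pq0 := pq4_gt0.
rewrite /rate /rate_real; case: ifPn => [xoo|].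
  have /andP[x1' x2'] := xoo; congr EFin.
  rewrite -/c y_fun_sqrB// /y_fun -/(N x).
  have n0 := rate_root_gt0 x2'.
  have z0 : 0 < 2 * x - 1 by lra.
  have w0 : 0 < 2 * (1 - x) by lra.
  have -> : 2 / (1 + N x / (2 * x - 1)) = 2 * (2 * x - 1) / (2 * x - 1 + N x).
    by field; rewrite !gt_eqF.
  have -> : 2 * (1 - x) * (N x / (2 * x - 1) * (1 + N x / (2 * x - 1)))
        / (4 * p * (1 - p)) =
      2 * (1 - x) * N x * (2 * x - 1 + N x) / (4 * p * (1 - p)) / (2 * x - 1) ^+ 2.
    by field; apply/and3P; split; rewrite gt_eqF ?subr_gt0// -subr_gt0.
  have q0 : 0 < 1 - p by rewrite subr_gt0.
  have w1 : 0 < 1 - x by rewrite subr_gt0.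
  rewrite !(ln_div, lnM, lnXn) ?posrE ?(mulr_gt0, divr_gt0, exprn_gt0, invr_gt0)//.
  by rewrite !mulr2n; field.
rewrite negb_and -!leNgt => /orP[x1'|x2'].
  have -> : x = 2^-1 by apply/eqP; rewrite eq_le x1 x1'.
  rewrite eqxx; congr EFin.
  have s1 : Num.sqrt ((1 - 2^-1) ^+ 2 + c * (2 * 2^-1 - 1)) = 2^-1 :> R.
    have -> : (1 - 2^-1) ^+ 2 + c * (2 * 2^-1 - 1) = 2^-1 ^+ 2 by field.
    by rewrite sqrtr_sqr ger0_norm.
  rewrite /rate_root -/c s1.
  have -> : 2 * (1 - 2^-1) = 1 :> R by field.
  have -> : 2 * 2^-1 - 1 = 0 :> R by field.
  have -> : 1 - 2^-1 + 2^-1 = 1 :> R by field.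
  rewrite add0r ln1 !mul0r.
  have -> : 4 * p * (1 - p) = 2 ^+ 2 * (p * (1 - p)) by ring.
  rewrite div1r lnV ?lnM ?lnXn ?posrE ?exprn_gt0 ?mulr_gt0 ?subr_gt0//.
  by rewrite mulr2n; field.
have -> : x = 1 by apply/eqP; rewrite eq_le x2 x2'.
rewrite eqxx ifF; last by apply/negbTE; lra.
congr EFin.
have -> : 2 * 1 - 1 = 1 :> R by ring.
have max0 : 0 < Num.max p (1 - p) by rewrite lt_max p_gt0.
have -> : 1 + N 1 = 2 * Num.max p (1 - p).
  rewrite /rate_root subrr expr0n /= !add0r.
  have -> : (1 - 4 * p * (1 - p)) * (2 * 1 - 1) = (1 - 2 * p) ^+ 2 by ring.
  rewrite sqrtr_sqr.
  have [h|h] := leP p (1 - p); first by rewrite ger0_norm; lra.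
  by rewrite ltr0_norm; lra.
rewrite subrr !mulr0 !mul0r ln1 div1r lnV ?lnM ?posrE//.
by ring.
Qed.

Lemma rate_outside x : ~~ (2^-1 <= x <= 1) -> rate p x = +oo%E.
Proof.
move=> h; rewrite /rate; case: ifPn => [/andP[/ltW x1 /ltW x2]|_].
  by rewrite x1 x2 in h.
by case: eqP => [xE|_]; [|case: eqP => [xE|//]];
  case/negP: h; rewrite xE; apply/andP; split; lra.
Qed.

Lemma within_continuous_rate : {within `[2^-1, 1], continuous (rate p)}.
Proof.
have : {within `[2^-1, 1], continuous (EFin \o rate_real p)}.
  apply: continuous_in_subspaceT => x; rewrite inE /= in_itv /= => hx.
  apply: (@cvg_EFin _ _ (nbhs x)); first exact: nearW.
  exact: continuous_rate_real.
move=> h; refine (@subspace_eq_continuous _ _ _ _ _ _ h).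
move=> x; rewrite inE /= in_itv /= => hx.
by rewrite /from_subspace /= rate_itvE.
Qed.

(** On [1/2, 1] the rate is continuous, and it jumps upwards to +oo outside. *)
Lemma lower_semicontinuous_rate : lower_semicontinuous (rate p).
Proof.
move=> x a ax; have [hx|hx] := boolP (2^-1 <= x <= 1).
  move: ax; rewrite rate_itvE// lte_fin => ax.
  exists [set y | a < rate_real p y].
    exact: (cvgr_gt _ (continuous_rate_real hx)).
  move=> y /= ay; have [hy|hy] := boolP (2^-1 <= y <= 1).
    by rewrite rate_itvE// lte_fin.
  by rewrite rate_outside// ltry.
exists [set y | ~~ (2^-1 <= y <= 1)]; last by move=> y /= hy; rewrite rate_outside// ltry.
move: hx; rewrite negb_and -!ltNge => /orP[h|h].
  by near=> y => /=; rewrite negb_and -!ltNge; apply/orP; left; near: y; exact: lt_nbhsl.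
by near=> y => /=; rewrite negb_and -!ltNge; apply/orP; right; near: y; exact: lt_nbhsr.
Unshelve. all: by end_near.
Qed.

Lemma compact_rate_sublevel (a : R) : compact [set x | (rate p x <= a%:E)%E].
Proof.
refine (subclosed_compact _ (@segment_compact R 2^-1 1) _).
- rewrite -openC (_ : ~` _ = [set x | (a%:E < rate p x)%E]).
    by move/lower_semicontinuousP : lower_semicontinuous_rate; exact.
  by apply/seteqP; split => x /=; rewrite ltNge => /negP.
- move=> x /=; rewrite in_itv /=; apply: contraPT => /rate_outside ->.
  by rewrite leye_eq.
Qed.

(** The number theta is chosen so that [root_disc] at theta is y_p(x).  Its
    sign is that of y - 1, hence that of (1 - x) - p q: x = 1 - p q is the limit
    of X_n / n. *)
Lemma rate_legendre x : 2^-1 < x < 1 -> exists theta : R,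
  [/\ rate p x = ((1 - x) * theta - ln (pf_eigenvalue p theta))%:E,
      is_derive theta 1 (@ln R \o pf_eigenvalue p) (1 - x),
      p * (1 - p) <= 1 - x -> 0 <= theta
    & 1 - x <= p * (1 - p) -> theta <= 0].
Proof.
move=> hx; have /andP[x1 x2] := hx; have y0 := y_fun_gt0 hx; have pq0 := pq4_gt0.
have yB := y_fun_sqrB_gt0 hx; have yB0 : 0 < (y_fun p x ^+ 2 - c) / (4 * p * (1 - p)).
  by rewrite divr_gt0.
pose theta := ln ((y_fun p x ^+ 2 - c) / (4 * p * (1 - p))).
have eE : 4 * p * (1 - p) * expR theta = y_fun p x ^+ 2 - c.
  by rewrite lnK ?posrE// mulrC divfK// gt_eqF.
have yE : root_disc p theta = y_fun p x.
  by rewrite /root_disc eE addrC subrK sqrtr_sqr ger0_norm ?ltW.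
exists theta; split.
- rewrite /rate hx /pf_eigenvalue yE -/c -/theta; congr EFin; congr (_ + _).
  by rewrite -lnV ?posrE ?divr_gt0 ?addr_gt0// invf_div.
- apply: is_derive_eq (is_derive_ln_pf p_gt0 p_lt1 theta) _.
  rewrite yE -/c y_fun_sqrB//; field.
  by rewrite !gt_eqF ?addr_gt0.
- move=> hw; rewrite ln_ge0// ler_pdivlMr// mul1r.
  have := y_fun_quad hx; have c0 : 0 <= c := disc_ge0 p.
  suff : 1 <= y_fun p x by rewrite /c; nra.
  rewrite leNgt; apply/negP => ylt1; have := y_fun_quad hx.
  rewrite /c in c0 *.
  have : 0 < (1 - y_fun p x) * ((2 * x - 1) * y_fun p x + c).
    by rewrite mulr_gt0 ?subr_gt0// ltr_wpDr// mulr_gt0//; lra.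
  rewrite /c; nra.
- move=> hw; rewrite ln_le0// ler_pdivrMr// mul1r.
  have c0 : 0 <= c := disc_ge0 p.
  suff : y_fun p x <= 1 by rewrite /c; nra.
  rewrite leNgt; apply/negP => ylt1; have := y_fun_quad hx.
  have : 0 < (y_fun p x - 1) * ((2 * x - 1) * y_fun p x + c).
    by rewrite mulr_gt0 ?subr_gt0// ltr_wpDr// mulr_gt0//; lra.
  rewrite /c; nra.
Qed.

(** On the open interval the tilt of [rate_legendre] attains the rate.  At the
    endpoints no finite tilt does, but by continuity the tilt of a nearby point
    does nearly as well: it is negative near 1 and positive near 1/2, so
    moving to the endpoint can only increase the linear term. *)
Lemma rate_lt_legendre x (a : R) : 2^-1 <= x <= 1 -> (a%:E < rate p x)%E ->
  exists theta : R, a < (1 - x) * theta - ln (pf_eigenvalue p theta).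
Proof.
move=> hx; rewrite rate_itvE// lte_fin => ax.
have near_a : \forall y \near x, a < rate_real p y.
  exact: (cvgr_gt _ (continuous_rate_real hx)).
have [x1|x1] := ltP 2^-1 x.
  have [x2|x2] := ltP x 1.
    have [|theta [rE _ _ _]] := @rate_legendre x; first exact/andP.
    by exists theta; rewrite -lte_fin -rE rate_itvE.
  have x1E : x = 1 by apply/eqP; rewrite eq_le x2; case/andP: hx => _ ->.
  rewrite {}x1E in near_a *.
  near (1 : R)^'- => y.
  have y1 : y < 1 by near: y; exact: nbhs_left_lt.
  have ylt : 2^-1 < y by near: y; apply: nbhs_left_gt; lra.
  have ypq : 1 - p * (1 - p) < y.
    by near: y; apply: nbhs_left_gt; rewrite ltrBlDr ltrDl mulr_gt0 ?subr_gt0.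
  have ay : a < rate_real p y by near: y; exact: cvg_at_left_filter near_a.
  have hy : 2^-1 < y < 1 by rewrite ylt y1.
  have [theta [rE _ _ th0]] := @rate_legendre y hy; exists theta.
  move: ay; rewrite -lte_fin -rate_itvE ?rE ?lte_fin ?(ltW y1) ?(ltW ylt)//.
  by have := th0 _; nra.
have xE : x = 2^-1 by apply/eqP; rewrite eq_le x1; case/andP: hx => ->.
rewrite {}xE in near_a *.
near (2^-1 : R)^'+ => y.
have y1 : y < 3 / 4 by near: y; apply: nbhs_right_lt; lra.
have ylt : 2^-1 < y by near: y; exact: nbhs_right_gt.
have ay : a < rate_real p y by near: y; exact: cvg_at_right_filter near_a.
have hy : 2^-1 < y < 1 by rewrite ylt; lra.
have [theta [rE _ th0 _]] := @rate_legendre y hy; exists theta.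
have hy' : 2^-1 <= y <= 1 by case/andP: hy => /ltW -> /ltW ->.
move: ay; rewrite -lte_fin -rate_itvE// rE lte_fin.
have pq : p * (1 - p) <= 1 - y.
  have : 0 <= (1 - 2 * p) ^+ 2 by exact: sqr_ge0.
  by rewrite expr2; lra.
by have := th0 pq; nra.
Unshelve. all: by end_near.
Qed.
End rate_properties.

(** * Chernoff bounds and exponential growth *)

Section finite_sums.
Context {R : realType}.
Variable p : R.
Hypotheses (p_gt0 : 0 < p) (p_lt1 : p < 1).
Local Notation L theta := (ln (pf_eigenvalue p theta)).

Definition bits_prob (n : nat) (Q : pred (seq bool)) : R :=
  \sum_(t : n.-tuple bool | Q t) weight p t.

(** With b = kappa / 3 and M = 1 + 1/b one has n + 1 <= M exp (n b), so two of
    the three factors exp (n b) absorb the quadratic, and the third still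
    diverges. *)
Lemma near_quadratic_expR (c kappa : R) : 0 < c -> 0 < kappa ->
  \forall n \near \oo, n.+1%:R ^+ 2 * expR (- (n%:R * kappa)) <= c.
Proof.
move=> c0 k0; have [b b0 kE] : exists2 b : R, 0 < b & kappa = 3 * b.
  by exists (kappa / 3); [rewrite divr_gt0|field].
have [M M0 ME] : exists2 M : R, 0 < M & M = 1 + b^-1.
  by exists (1 + b^-1) => //; rewrite addr_gt0 ?invr_gt0.
near=> n.
have n1 : n.+1%:R <= M * expR (n%:R * b).
  apply: le_trans (_ : M * (1 + n%:R * b) <= _).
    rewrite -natr1 ME.
    have -> : (1 + b^-1) * (1 + n%:R * b) = n%:R + 1 + (b^-1 + n%:R * b).
      by field; rewrite gt_eqF.
    by rewrite lerDl addr_ge0 ?mulr_ge0 ?invr_ge0 ?(ltW b0).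
  by rewrite ler_pM2l// expR_ge1Dx.
rewrite expRN ler_pdivrMr ?expR_gt0//.
have -> : expR (n%:R * kappa) = expR (n%:R * b) ^+ 2 * expR (n%:R * b).
  by rewrite -expRM_natl -expRD; congr expR; rewrite kE; ring.
have h : n.+1%:R ^+ 2 <= (M * expR (n%:R * b)) ^+ 2.
  by rewrite lerXn2r// nnegrE ?mulr_ge0 ?expR_ge0 ?(ltW M0).
apply: le_trans h _.
rewrite exprMn [leLHS]mulrC.
rewrite (_ : c * _ = expR (n%:R * b) ^+ 2 * (c * expR (n%:R * b))); last by ring.
rewrite ler_pM2l ?exprn_gt0 ?expR_gt0// -ler_pdivrMl//.
apply: le_trans (expR_ge1Dx _); apply: ler_wpDl => //.
by rewrite -ler_pdivrMr//; near: n; exact: nbhs_infty_ger.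
Unshelve. all: by end_near.
Qed.

Lemma prob_le n (Q1 Q2 : pred (seq bool)) :
  (forall t, size t = n -> Q1 t -> Q2 t) -> bits_prob n Q1 <= bits_prob n Q2.
Proof.
move=> Q12; rewrite /bits_prob big_mkcond [leRHS]big_mkcond; apply: ler_sum => t _.
case: ifPn => [/Q12->|_]; rewrite ?size_tuple//.
by case: ifP => // _; rewrite ltW// weight_gt0.
Qed.

Lemma prob_total n : bits_prob n xpredT = 1.
Proof.
elim: n => [|n IHn].
  rewrite /bits_prob (big_pred1 [tuple of [::]]) => [|t]; last by apply/esym/eqP; exact: tuple0.
  by rewrite /weight big_nil.
rewrite /bits_prob sum_tupleS.
under eq_bigr do rewrite /weight big_cons.
under [X in _ + X]eq_bigr do rewrite /weight big_cons.
by rewrite -!mulr_sumr -mulrDl -/(bits_prob n xpredT) IHn; ring.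
Qed.

Lemma expR_pf_eigenvalue theta n :
  pf_eigenvalue p theta ^+ n = expR (n%:R * L theta).
Proof. by rewrite expRM_natl lnK// posrE pf_eigenvalue_gt0. Qed.

(** On [Q] the factor exp (tau W - a) is at least 1, and inserting it turns the
    sum into a moment generating function at theta + tau. *)
Lemma chernoff_tilted n (theta tau a : R) (Q : pred (seq bool)) :
  (forall t, size t = n -> Q t -> a <= tau * (rises true t)%:R) ->
  \sum_(t : n.-tuple bool | Q t) weight p t * expR (theta * (rises true t)%:R)
    <= n.+1%:R * expR (n%:R * L (theta + tau) - a).
Proof.
move=> Qa; rewrite expRB mulrA ler_pdivlMr ?expR_gt0// -expR_pf_eigenvalue.
apply: le_trans (rise_mgf_le p_gt0 p_lt1 n (theta + tau)).
rewrite /rise_mgf mulr_suml big_mkcond; apply: ler_sum => t _.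
have w0 := weight_gt0 p_gt0 p_lt1 t.
case: ifPn => [/Qa h|_]; last by rewrite mulr_ge0 ?expR_ge0 ?ltW.
by rewrite -mulrA ler_pM2l// -expRD ler_expR mulrDl lerD2l h ?size_tuple.
Qed.

Lemma chernoff n (theta a : R) (Q : pred (seq bool)) :
  (forall t, size t = n -> Q t -> a <= theta * (rises true t)%:R) ->
  bits_prob n Q <= n.+1%:R * expR (n%:R * L theta - a).
Proof.
move=> /chernoff_tilted-/(_ 0); rewrite add0r; apply: le_trans.
by apply: ler_sum => t _; rewrite mul0r expR0 mulr1.
Qed.

(** Applied to the logarithm of the dominant eigenvalue, this leaves both
    tails around the tilted mean exponentially smaller than the tilted total. *)
Lemma is_derive_tail (f : R -> R) (theta w delta : R) :
  is_derive theta 1 f w -> 0 < delta -> exists tau, [/\ 0 < tau,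
    f (theta + tau) - f theta < tau * (w + delta) &
    f (theta - tau) - f theta < - tau * (w - delta)].
Proof.
move=> [df fE] d0; move: fE; rewrite /derive => fE.
have := df; rewrite /derivable => /cvg_ex[l fl].
have lE : l = w by rewrite -fE; apply/esym/cvg_lim.
rewrite {}lE in fl.
move/cvgrPdist_lt : fl => /(_ _ d0).
rewrite near_withinE => -[e /= e0 he].
have e2 : 0 < e / 2 by rewrite divr_gt0.
exists (e / 2).
have h1 : ball_ [eta Num.norm] 0 e (e / 2).
  by rewrite /= sub0r normrN gtr0_norm//; lra.
have h2 : ball_ [eta Num.norm] 0 e (- (e / 2)).
  by rewrite /= sub0r opprK gtr0_norm//; lra.
have n1 : e / 2 != 0 by rewrite gt_eqF.
have n2 : - (e / 2) != 0 by rewrite oppr_eq0 gt_eqF.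
have := he _ h1 n1; have := he _ h2 n2.
rewrite /GRing.scale /= !mulr1 !ltr_distlC ![_ + theta]addrC.
move: (e / 2) e2 {h1 h2 n1 n2} => t t0 /andP[a1 a2] /andP[b1 b2].
split => //.
  by rewrite -ltr_pdivrMl//.
move: a1; rewrite invrN mulNr -mulrN -(ltr_pM2l t0) mulrA divff ?gt_eqF// mul1r.
lra.
Qed.
End finite_sums.

(** * Large deviation bounds for the number of rises *)

Section bounds.
Context {R : realType}.
Variable p : R.
Hypotheses (p_gt0 : 0 < p) (p_lt1 : p < 1).
Local Notation L theta := (ln (pf_eigenvalue p theta)).

(** The value that X_n / n would take without the bounded error. *)
Definition no_rise_frac (t : seq bool) : R :=
  1 - (rises true t)%:R / (size t)%:R.

Lemma no_rise_frac_itv (t : seq bool) : 2^-1 <= no_rise_frac t <= 1.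
Proof.
have := rises_le_half true t; rewrite /no_rise_frac addn0 => h.
have [->|t0] := eqVneq (size t) 0%N; first by rewrite invr0 mulr0; lra.
have {}t0 : 0 < (size t)%:R :> R by rewrite ltr0n lt0n.
have hr : (rises true t)%:R * 2 <= (size t)%:R :> R.
  by rewrite -natrM ler_nat muln2.
have : (rises true t)%:R / (size t)%:R <= 2^-1 :> R.
  by rewrite ler_pdivrMr//; lra.
have : 0 <= (rises true t)%:R / (size t)%:R :> R by rewrite divr_ge0.
by lra.
Qed.

Lemma rises_eq_frac n (t : seq bool) : (0 < n)%N -> size t = n ->
  (rises true t)%:R = n%:R * (1 - no_rise_frac t).
Proof.
move=> n0 st; rewrite /no_rise_frac st; field.
by rewrite pnatr_eq0 -lt0n.
Qed.

Lemma prob_rises_le n (a : R) (t : seq bool) : (0 < n)%N -> size t = n ->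
  (a%:E < rate p (no_rise_frac t))%E ->
  bits_prob p n [pred u | rises true u == rises true t] <= n.+1%:R * expR (- (n%:R * a)).
Proof.
move=> n0 st /(rate_lt_legendre p_gt0 p_lt1 (no_rise_frac_itv t))[theta ha].
have n0' : 0 < n%:R :> R by rewrite ltr0n.
apply: le_trans (@chernoff _ _ p_gt0 p_lt1 n theta (theta * (rises true t)%:R) _ _) _.
  by move=> u su /= /eqP ->.
rewrite ler_pM2l// ler_expR (rises_eq_frac n0 st).
by move: (no_rise_frac t) ha => x ha; nra.
Qed.

(** The number of rises takes at most n + 1 values, and [prob_rises_le] bounds
    the probability of each of them. *)
Lemma prob_upper (n : nat) (a : R) (Q : pred (seq bool)) : (0 < n)%N ->
  (forall t, size t = n -> Q t -> (a%:E < rate p (no_rise_frac t))%E) ->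
  bits_prob p n Q <= n.+1%:R ^+ 2 * expR (- (n%:R * a)).
Proof.
move=> n0 Qa.
have rn (t : n.-tuple bool) : (rises true t < n.+1)%N.
  have := rises_le_half true t; rewrite size_tuple addn0 ltnS => h.
  by apply: leq_trans h; rewrite -addnn leq_addr.
pose W (t : n.-tuple bool) : 'I_n.+1 := inord (rises true t).
rewrite /bits_prob (partition_big W predT) //= /W.
have -> : n.+1%:R ^+ 2 * expR (- (n%:R * a)) =
    \sum_(k < n.+1) (n.+1%:R * expR (- (n%:R * a))).
  by rewrite sumr_const card_ord -[RHS]mulr_natl mulrA.
apply: ler_sum => k _.
have [[t /andP[Qt tk]]|noQ] :=
  pselect (exists t : n.-tuple bool, Q t && (inord (rises true t) == k)).
  apply: le_trans (prob_rises_le n0 (size_tuple t) (Qa t (size_tuple t) Qt)).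
  rewrite /bits_prob big_mkcond [leRHS]big_mkcond; apply: ler_sum => u _ /=.
  case: ifPn => [/andP[_ /eqP uk]|_].
    suff -> : rises true u == rises true t by [].
    by rewrite -(inordK (rn u)) -(inordK (rn t)) uk (eqP tk).
  by case: ifP => // _; rewrite ltW// weight_gt0.
rewrite big1 ?mulr_ge0 ?expR_ge0// => t h; exfalso; apply: noQ.
by exists t.
Qed.

(** Exponential tilting with the theta of [rate_legendre].  The sum of the
    tilted weights is at least c lambda^n, of which the part outside the window
    is at most a half, since both tails carry an extra factor exp (- n kappa).
    Inside the window, undoing the tilt costs
    exp (- n (theta (1 - x) + eta / 2)). *)
Lemma prob_lower (x delta eta r : R) : 2^-1 < x < 1 -> rate p x = r%:E ->
  0 < delta -> 0 < eta ->
  \forall n \near \oo, expR (- (n%:R * (r + eta))) <=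
    bits_prob p n [pred t | `|no_rise_frac t - x| < delta].
Proof.
move=> hx rE d0 e0.
have [theta [rE' dL _ _]] := rate_legendre p_gt0 p_lt1 hx.
move: rE'; rewrite rE => -[{}rE].
set w := 1 - x in rE dL.
(* Undoing the tilt over a window of half-width d costs exp (n |theta| d),
   which must stay below exp (n eta / 2). *)
pose d := Num.min delta (eta / (2 * (1 + `|theta|))).
have th0 : 0 < 1 + `|theta| by rewrite ltr_pwDl.
have dgt0 : 0 < d by rewrite lt_min d0 divr_gt0// mulr_gt0.
have dled : d <= delta by rewrite ge_min lexx.
have dth : `|theta| * d <= eta / 2.
  have : d <= eta / (2 * (1 + `|theta|)) by rewrite ge_min lexx orbT.
  rewrite ler_pdivlMr ?mulr_gt0// => h.
  have := normr_ge0 theta; move: (`|theta|) h => u h u0; nra.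
have [tau [t0 h1 h2]] := is_derive_tail dL dgt0.
rewrite /= in h1 h2.
(* kappa is the exponential gain of the worse of the two tails. *)
pose kappa := Num.min (tau * (w + d) - (L (theta + tau) - L theta))
  (- tau * (w - d) - (L (theta - tau) - L theta)).
have k0 : 0 < kappa by rewrite lt_min !subr_gt0 h1 h2.
have k1 : L (theta + tau) - tau * (w + d) <= L theta - kappa.
  have : kappa <= tau * (w + d) - (L (theta + tau) - L theta) by rewrite ge_min lexx.
  by lra.
have k2 : L (theta - tau) + tau * (w - d) <= L theta - kappa.
  have : kappa <= - tau * (w - d) - (L (theta - tau) - L theta).
    by rewrite ge_min lexx orbT.
  by lra.
move: kappa k0 k1 k2 => kappa k0 k1 k2.
have [c c0 cle] := rise_mgf_ge p_gt0 p_lt1 theta.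
have c4 : 0 < c / 4 by rewrite divr_gt0.
have c2 : 0 < c / 2 by rewrite divr_gt0.
have e2 : 0 < eta / 2 by rewrite divr_gt0.
near=> n.
have n0 : (0 < n)%N by near: n; exact: nbhs_infty_gt.
have n0' : 0 < n%:R :> R by rewrite ltr0n.
have g1 : n.+1%:R ^+ 2 * expR (- (n%:R * kappa)) <= c / 4.
  by near: n; exact: near_quadratic_expR.
have g2 : n.+1%:R ^+ 2 * expR (- (n%:R * (eta / 2))) <= c / 2.
  by near: n; exact: near_quadratic_expR.
pose F (t : seq bool) := weight p t * expR (theta * (rises true t)%:R).
pose S (Q : pred (seq bool)) := \sum_(t : n.-tuple bool | Q t) F t.
have F0 t : 0 <= F t by rewrite mulr_ge0 ?expR_ge0// ltW// weight_gt0.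
pose Qc := [pred t | `|no_rise_frac t - x| < d].
pose Q1 := [pred t : seq bool | n%:R * (w + d) <= (rises true t)%:R].
pose Q2 := [pred t : seq bool | (rises true t)%:R <= n%:R * (w - d)].
have tail (a : R) : a <= n%:R * (L theta - kappa) ->
    n.+1%:R * expR a <= c / 4 * expR (n%:R * L theta).
  move=> ha; apply: (@le_trans _ _
    (n.+1%:R ^+ 2 * expR (- (n%:R * kappa)) * expR (n%:R * L theta))).
    rewrite -mulrA -expRD expr2 -mulrA ler_pM2l//.
    apply: (@le_trans _ _ (1 * expR a)); first by rewrite mul1r.
    apply: ler_pM; rewrite ?expR_ge0 ?ler1n// ler_expR.
    by apply: le_trans ha _; rewrite mulrBr addrC.
  by rewrite ler_pM2r ?expR_gt0.
have S1 : S Q1 <= c / 4 * expR (n%:R * L theta).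
  apply: le_trans (chernoff_tilted p_gt0 p_lt1 theta
    (tau := tau) (a := tau * (n%:R * (w + d))) _) _.
    by move=> t _ /= h; rewrite ler_pM2l.
  apply: tail; nra.
have S2 : S Q2 <= c / 4 * expR (n%:R * L theta).
  apply: le_trans (chernoff_tilted p_gt0 p_lt1 theta
    (tau := - tau) (a := - tau * (n%:R * (w - d))) _) _.
    by move=> t _ /= h; rewrite ler_nM2l// oppr_lt0.
  apply: tail; nra.
have SE : rise_mgf p true n theta <= S Qc + S Q1 + S Q2.
  rewrite /rise_mgf /S [X in X + _ + _]big_mkcond [X in _ + X + _]big_mkcond.
  rewrite [X in _ + X]big_mkcond -!big_split /=; apply: ler_sum => t _.
  rewrite -/(F t); have Ft := F0 t.
  have [hc|] := ltP; first by rewrite -addrA lerDl addr_ge0//; case: ifP.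
  rewrite add0r ler_normr (rises_eq_frac n0 (size_tuple t)) => /orP[h|h].
    rewrite (@ifT _ (_ <= n%:R * (w - d))); last by rewrite ler_pM2l// /w; lra.
    by rewrite lerDr; case: ifP.
  rewrite (@ifT _ (n%:R * (w + d) <= _)); last by rewrite ler_pM2l// /w; lra.
  by rewrite lerDl; case: ifP.
have SQc : c / 2 * expR (n%:R * L theta) <= S Qc.
  have := cle n; rewrite expR_pf_eigenvalue//.
  by move: (expR (n%:R * L theta)) S1 S2 SE => E; lra.
have PQ : S Qc <= bits_prob p n Qc * expR (n%:R * (theta * w + eta / 2)).
  rewrite /S /bits_prob mulr_suml; apply: ler_sum => t Qt.
  rewrite /F ler_pM2l ?weight_gt0// ler_expR (rises_eq_frac n0 (size_tuple t)).
  rewrite mulrCA ler_pM2l//.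
  have : theta * (x - no_rise_frac t) <= `|theta| * d.
    apply: le_trans (ler_norm _) _; rewrite normrM ler_wpM2l// distrC ltW//.
  by rewrite /w; lra.
apply: (@le_trans _ _ (bits_prob p n Qc)); last first.
  by apply: prob_le => // t _ /= h; apply: lt_le_trans h _.
rewrite -(ler_pM2r (expR_gt0 (n%:R * (theta * w + eta / 2)))).
apply: le_trans _ PQ; apply: le_trans _ SQc.
rewrite -expRD.
have -> : - (n%:R * (r + eta)) + n%:R * (theta * w + eta / 2) =
  - (n%:R * (eta / 2)) + n%:R * L theta.
  by rewrite rE; field.
rewrite expRD ler_pM2r ?expR_gt0//; apply: le_trans _ g2.
by rewrite ler_peMl ?expR_ge0 // exprn_ege1 // ler1n.
Unshelve. all: by end_near.
Qed.

(** A negative value of the rate would make the lower bound of [prob_lower]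
    exceed 1. *)
Lemma rate_ge0 x : (0 <= rate p x)%E.
Proof.
have interior y : 2^-1 < y < 1 -> 0 <= rate_real p y.
  move=> hy; have hy' : 2^-1 <= y <= 1 by case/andP: hy => /ltW-> /ltW->.
  apply/ler_addgt0Pr => eta e0.
  have := prob_lower hy (rate_itvE p_gt0 p_lt1 hy') ltr01 e0.
  move=> /filterI/(_ (nbhs_infty_gt 0))/filter_ex[n [hn n0]].
  have n0' : 0 < n%:R :> R by rewrite ltr0n.
  have := le_trans hn (prob_le p_gt0 p_lt1 (Q2 := xpredT) (fun t _ _ => isT)).
  by rewrite prob_total -[leRHS]expR0 ler_expR oppr_le0 pmulr_rge0.
have [xoo|] := boolP ((2^-1 < x) && (x < 1)).
  by rewrite rate_itvE ?lee_fin ?interior//; case/andP: xoo => /ltW-> /ltW->.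
rewrite /rate => /negbTE ->; case: eqP => _.
  rewrite lee_fin mulr_ge0 ?invr_ge0// ln_ge0// div1r invf_ge1 ?mulr_gt0 ?subr_gt0//.
  by rewrite mulr_ile1// ?subr_ge0 ?(ltW p_gt0) ?(ltW p_lt1)// lerBlDr lerDl ltW.
case: eqP => _; last exact: le0y.
rewrite lee_fin ln_ge0// div1r invf_ge1 ?lt_max ?p_gt0//.
by rewrite ge_max (ltW p_lt1) lerBlDr lerDl ltW.
Qed.

Lemma good_rate_function_rate : good_rate_function (rate p).
Proof.
split; [exact: rate_ge0|exact: lower_semicontinuous_rate|].
by move=> a _; exact: compact_rate_sublevel.
Qed.
End bounds.

(** * The law of the number of correct guesses *)

Definition coins_of_bits (n : nat) (t : seq bool) : {ffun 'I_n -> bool} :=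
  [ffun i => nth false t (val i)].

Lemma bits_of_coins n t : size t = n ->
  [seq coins_of_bits n t i | i <- enum 'I_n] = t.
Proof.
move=> st; apply: (@eq_from_nth _ false); first by rewrite size_map size_enum_ord.
rewrite size_map size_enum_ord => i ltin.
rewrite (nth_map (Ordinal ltin)) ?size_enum_ord// ffunE.
by rewrite (nth_ord_enum (Ordinal ltin) (Ordinal ltin)).
Qed.

Section law.
Context {R : realType} (p : R) (n : nat) d (T : measurableType d).
Context (P : probability T R) (eps : 'I_n -> {RV P >-> bool}).
Hypothesis eps_indep : mutually_independent eps.
Hypothesis eps_bernoulli : forall i, P (eps i @^-1` [set true]) = p%:E.

Lemma measurable_eps i b : measurable (eps i @^-1` [set b]).
Proof. by rewrite -[X in measurable X]setTI; exact: measurable_funP. Qed.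

Lemma eps_marginal i b : P (eps i @^-1` [set b]) = (if b then p else 1 - p)%:E.
Proof.
case: b => //.
have -> : eps i @^-1` [set false] = ~` (eps i @^-1` [set true]).
  by apply/seteqP; split => w /=; case: (eps i w).
by rewrite probability_setC ?eps_bernoulli//; exact: measurable_eps.
Qed.

Lemma joint_law (e : {ffun 'I_n -> bool}) :
  P (\bigcap_i (eps i @^-1` [set e i])) =
    (\prod_i (if e i then p else 1 - p))%:E.
Proof.
have := eps_indep [set: 'I_n]%SET (B := fun i => [set e i]) (fun=> I).
rewrite (_ : [set` _] = setT); last by apply/seteqP; split => i //=; rewrite inE.
move=> ->; rewrite -prodEFin; apply: eq_big => [i|i _]; first by rewrite inE.
exact: eps_marginal.
Qed.

(** The coins are jointly distributed as independent coins of bias p, and the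
    event is the disjoint union of the cylinders of the coin sequences that
    realize it. *)
Lemma law_scaled_correct (A : set R) :
  P (scaled_correct_RV p eps @^-1` A) = (bits_prob p n
    [pred t | `[< A ((num_correct p (coins_of_bits n t))%:R / n%:R) >]])%:E.
Proof.
pose g (e : {ffun 'I_n -> bool}) : R := (num_correct p e)%:R / n%:R.
pose cyl (e : {ffun 'I_n -> bool}) := \bigcap_i (eps i @^-1` [set e i]).
pose s := [seq e <- enum {: {ffun 'I_n -> bool}} | `[< A (g e) >]].
have -> : scaled_correct_RV p eps @^-1` A = \bigcup_(e in [set` s]) cyl e.
  apply/seteqP; split => [w Aw | w [e]].
    exists [ffun i => eps i w] => [|i _ /=]; last by rewrite ffunE.
    by rewrite /= mem_filter mem_enum andbT; exact/asboolP.
  rewrite /= mem_filter => /andP[/asboolP Ae _] ew.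
  rewrite /scaled_correct_RV /= /scaled_correct.
  suff -> : [ffun i => eps i w] = e by [].
  by apply/ffunP => i; rewrite ffunE; exact: ew.
rewrite measure_fin_bigcup//; last 2 first.
- by move=> e1 e2 _ _ [w [h1 h2]]; apply/ffunP => i; rewrite -(h1 i I) -(h2 i I).
- move=> e _; apply: fin_bigcap_measurable => [|i _]; first exact: finite_finset.
  exact: measurable_eps.
rewrite -fsbig_seq; last by apply: filter_uniq; exact: enum_uniq.
rewrite /s big_filter big_enum_cond /=.
under eq_bigr do rewrite joint_law.
rewrite sumEFin; congr EFin; rewrite /bits_prob.
rewrite (reindex (fun t : n.-tuple bool => coins_of_bits n t)) /=.
  apply: eq_big => [t|t _]; first by rewrite /=.
  rewrite /weight big_tuple; apply: eq_bigr => i _.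
  by rewrite ffunE (tnth_nth false).
exists (fun e : {ffun 'I_n -> bool} => [tuple e i | i < n]) => [t|e] _.
  by apply: eq_from_tnth => i; rewrite tnth_mktuple ffunE (tnth_nth false).
by apply/ffunP => i; rewrite ffunE -tnth_nth tnth_mktuple.
Qed.
End law.

(** * From exponential bounds to the large deviation principle *)

Section limits.
Context {R : realType}.

Lemma limn_esup_le_near (u : (\bar R)^nat) (b : \bar R) :
  (\forall n \near \oo, (u n <= b)%E) -> (limn_esup u <= b)%E.
Proof.
move=> [N _ ub]; rewrite limn_esup_lim; apply: lime_le; first exact: is_cvg_esups.
exists N => // n /= Nn; apply: ge_ereal_sup => _ [m /= nm <-].
by apply: ub => /=; exact: leq_trans nm.
Qed.

Lemma limn_einf_ge_near (u : (\bar R)^nat) (b : \bar R) :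
  (\forall n \near \oo, (b <= u n)%E) -> (b <= limn_einf u)%E.
Proof.
move=> bu; rewrite -leeN2 -limn_esupN; apply: limn_esup_le_near.
by near=> n; rewrite /= leeN2; near: n.
Unshelve. all: by end_near.
Qed.

Lemma scaled_log_le (x a : R) (n : nat) : (0 < n)%N -> 0 <= x ->
  x <= expR (- (n%:R * a)) -> ((n%:R^-1)%:E * lne x%:E <= (- a)%:E)%E.
Proof.
move=> n0 x0 xa; have n0' : 0 < n%:R :> R by rewrite ltr0n.
have [->|xn0] := eqVneq x 0.
  by rewrite le0_lneNy// gt0_muleNy ?leNye// lte_fin invr_gt0.
have {}x0 : 0 < x by rewrite lt_neqAle eq_sym xn0.
rewrite lne_EFin// -EFinM lee_fin ler_pdivrMl// mulrN.
by rewrite -(expRK (- _)) ler_ln// posrE expR_gt0.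
Qed.

Lemma scaled_log_ge (x a : R) (n : nat) : (0 < n)%N ->
  expR (- (n%:R * a)) <= x -> ((- a)%:E <= (n%:R^-1)%:E * lne x%:E)%E.
Proof.
move=> n0 xa; have n0' : 0 < n%:R :> R by rewrite ltr0n.
have x0 : 0 < x by apply: lt_le_trans xa; exact: expR_gt0.
rewrite lne_EFin// -EFinM lee_fin ler_pdivlMl// mulrN.
by rewrite -(expRK (- _)) ler_ln// posrE expR_gt0.
Qed.

Lemma lee_from_below (x y : \bar R) :
  (forall a : R, (a%:E < x)%E -> (a%:E <= y)%E) -> (x <= y)%E.
Proof.
case: x => [r| |] h; last exact: leNye.
  apply/lee_addgt0Pr => e e0; rewrite -leeBlDr// -EFinB; apply: h.
  by rewrite lte_fin ltrBlDr ltrDl.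
rewrite leye_eq; apply/eqP/eqyP => A _; apply: h; exact: ltry.
Qed.
End limits.

Section large_deviations.
Context {R : realType}.
Variable p : R.
Hypotheses (p_gt0 : 0 < p) (p_lt1 : p < 1).
Let X (n : nat) (t : seq bool) : R := (num_correct p (coins_of_bits n t))%:R / n%:R.
Let C : R := `|nu p|.+1%:R.

Lemma scaled_correct_near_frac (n : nat) (t : seq bool) :
  (0 < n)%N -> size t = n -> `|X n t - no_rise_frac t| <= C / n%:R.
Proof.
move=> n0 st; have n0' : 0 < n%:R :> R by rewrite ltr0n.
have := num_correct_add_rises p (coins_of_bits n t).
rewrite bits_of_coins// /X /no_rise_frac st.
set x := num_correct _ _; set W := rises _ _ => -[].
rewrite -!(ler_nat R) !natrD -/C => h1 h2.
have -> : x%:R / n%:R - (1 - W%:R / n%:R) = (x%:R + W%:R - n%:R) / n%:R :> R.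
  by field; rewrite gt_eqF.
rewrite normrM (gtr0_norm (x := n%:R^-1)) ?invr_gt0// ler_pM2r ?invr_gt0//.
by rewrite ler_norml; lra.
Qed.

Let Q n (A : set R) : pred (seq bool) := [pred t | `[< A (X n t) >]].

(** The sublevel set of [a] is compact and misses the closure of [A], so its
    points keep a uniform distance from [A], which eventually exceeds the error
    C / n of [scaled_correct_near_frac]. *)
Lemma prob_upper_closure (A : set R) (a : R) :
  (forall x, closure A x -> (a%:E < rate p x)%E) ->
  \forall n \near \oo,
    bits_prob p n (Q n A) <= n.+1%:R ^+ 2 * expR (- (n%:R * a)).
Proof.
move=> Aa.
have /compact_near_coveringP : compact [set x | (rate p x <= a%:E)%E].
  exact: compact_rate_sublevel.
move=> /(_ nat \oo (fun n x => forall z, A z -> C / n%:R < `|z - x|)).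
case.
- move=> x /= xa.
  have : (~` closure A) x by move=> /Aa; rewrite ltNge xa.
  rewrite -interiorC => -[r /= r0 br].
  have r2 : 0 < r / 2 by rewrite divr_gt0.
  near=> y n => /= z Az.
  have xz : r <= `|z - x|.
    rewrite leNgt distrC; apply/negP => zr.
    exact: (br z zr).
  have yx : `|y - x| < r / 2 by rewrite distrC; near: y; exact: nbhsx_ballx.
  have n0 : 0 < n%:R :> R by near: n; exact: nbhs_infty_gtr.
  have Cn : C / n%:R < r / 2.
    rewrite ltr_pdivrMr// mulrC -ltr_pdivrMr//; near: n; exact: nbhs_infty_gtr.
  have : `|z - x| <= `|z - y| + `|y - x| by exact: ler_distD.
  lra.
move=> N _ hN; exists (maxn N 1) => // n /=; rewrite geq_max => /andP[Nn n0].
apply: prob_upper => // t st /asboolP At; rewrite ltNge; apply/negP => ta.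
have := hN n Nn _ ta _ At.
by rewrite ltNge scaled_correct_near_frac.
Unshelve. all: by end_near.
Qed.

(** By continuity of the rate, an interior point of [A] may be replaced by a
    point of the open interval with nearly the same rate; a window around
    that point stays in [A] despite the error C / n. *)
Lemma prob_lower_interior (A : set R) (x eta : R) :
  2^-1 <= x <= 1 -> interior A x -> 0 < eta ->
  \forall n \near \oo, expR (- (n%:R * (rate_real p x + eta))) <= bits_prob p n (Q n A).
Proof.
move=> hx Ax e0.
have near_x : \forall y \near x, interior A y /\ rate_real p y < rate_real p x + eta / 2.
  near=> y; split; first by near: y; exact: nbhs_interior.
  near: y; apply: (cvgr_lt _ (continuous_rate_real hx)); rewrite ltrDl divr_gt0//.
have [y [hy [Ay ry]]] : exists y, 2^-1 < y < 1 /\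
    (interior A y /\ rate_real p y < rate_real p x + eta / 2).
  have /andP[x1 x2] := hx.
  have [xlt1|xge1] := ltP x 1.
    (* The point is taken towards the inside of the interval. *)
    near x^'+ => y; exists y; split; last by near: y; exact: cvg_within near_x.
    apply/andP; split; last by near: y; exact: nbhs_right_lt.
    by apply: le_lt_trans x1 _; near: y; exact: nbhs_right_gt.
  have x1E : x = 1 by apply/eqP; rewrite eq_le x2.
  near x^'- => y; exists y; split; last by near: y; exact: cvg_within near_x.
  apply/andP; split; last by rewrite -x1E; near: y; exact: nbhs_left_lt.
  by near: y; apply: nbhs_left_gt; rewrite x1E; lra.
have [r /= r0 br] := Ay.
have r2 : 0 < r / 2 by rewrite divr_gt0.
have e2 : 0 < eta / 2 by rewrite divr_gt0.
have hy' : 2^-1 <= y <= 1 by case/andP: hy => /ltW-> /ltW->.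
have low := prob_lower p_gt0 p_lt1 hy (rate_itvE p_gt0 p_lt1 hy') r2 e2.
near=> n.
have n0 : (0 < n)%N by near: n; exact: nbhs_infty_gt.
have n0' : 0 < n%:R :> R by rewrite ltr0n.
have Cn : C / n%:R < r / 2.
  rewrite ltr_pdivrMr// mulrC -ltr_pdivrMr//; near: n; exact: nbhs_infty_gtr.
apply: (@le_trans _ _ (bits_prob p n [pred t | `|no_rise_frac t - y| < r / 2])).
  apply: (@le_trans _ _ (expR (- (n%:R * (rate_real p y + eta / 2))))).
    by rewrite ler_expR lerN2 ler_pM2l//; lra.
  by near: n; exact: low.
apply: prob_le => // t st /= ty; apply/asboolP; apply: br => /=.
rewrite distrC; have := scaled_correct_near_frac n0 st.
have := ler_distD (no_rise_frac t) (X n t) y; lra.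
Unshelve. all: by end_near.
Qed.
End large_deviations.

Theorem theorem6 (R : realType) (p : R) (hp : 0 < p < 1)
  (d : nat -> measure_display) (T : forall n : nat, measurableType (d n))
  (P : forall n : nat, probability (T n) R)
  (eps : forall n : nat, 'I_n -> {RV (P n) >-> bool})
  (eps_indep : forall n : nat, mutually_independent (eps n))
  (eps_bernoulli : forall (n : nat) (i : 'I_n),
      P n (eps n i @^-1` [set true]) = p%:E) :
  [/\ {within `[2^-1, 1], continuous (rate p)},
      good_rate_function (rate p)
    & satisfies_LDP (fun n => scaled_correct_RV p (eps n)) (rate p)].
Proof.
have /andP[p_gt0 p_lt1] := hp.
split; [exact: within_continuous_rate|exact: good_rate_function_rate|].
split; first exact: good_rate_function_rate.
move=> A mA; split; last 1 first.
- rewrite leeNr; apply: lee_from_below => a aJ; rewrite leeNr -EFinN.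
  apply/lee_addgt0Pr => e e0; rewrite -EFinD.
  have := @prob_upper_closure _ _ p_gt0 p_lt1 A a.
  case=> [x Ax|N _ hN].
    by apply: lt_le_trans aJ _; apply: ereal_inf_lbound; exists x.
  apply: limn_esup_le_near; near=> n.
  have n0 : (0 < n)%N by near: n; exact: nbhs_infty_gt.
  have -> : - a + e = - (a - e) by rewrite opprB addrC.
  rewrite law_scaled_correct//; apply: scaled_log_le => //.
    by apply: sumr_ge0 => t _; rewrite ltW// weight_gt0.
  have Nn : (N <= n)%N by near: n; exact: nbhs_infty_ge.
  apply: le_trans (hN _ Nn) _.
  have -> : - (n%:R * (a - e)) = n%:R * e + - (n%:R * a) by ring.
  rewrite expRD ler_pM2r ?expR_gt0//.
  have : n.+1%:R ^+ 2 * expR (- (n%:R * e)) <= 1.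
    by near: n; exact: near_quadratic_expR.
  by rewrite expRN ler_pdivrMr ?expR_gt0// mul1r.
- rewrite leeNl; apply/ereal_infP => _ [x Ax <-].
  have [hx|hx] := boolP (2^-1 <= x <= 1); last by rewrite rate_outside// leey.
  rewrite rate_itvE//; apply/lee_addgt0Pr => e e0; rewrite -EFinD leeNl -EFinN.
  apply: limn_einf_ge_near.
  have := @prob_lower_interior _ _ p_gt0 p_lt1 A x e hx Ax e0 => hn.
  near=> n.
  have n0 : (0 < n)%N by near: n; exact: nbhs_infty_gt.
  rewrite law_scaled_correct//; apply: scaled_log_ge => //.
  by near: n; exact: hn.
- exact: limn_einf_sup.
Unshelve. all: by end_near.
Qed.
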